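(* Let $a,b,c,d\in\mathbb{H}_s$ with $b\neq 0$ and $c\neq 0$, and let $A=\begin{pmatrix} a&b\\ c&d\end{pmatrix}\in \mathbb{H}_s^{2\times 2}$. Then the following hold. (1) If $S_Q(b,a-d,-c)\neq\emptyset$, then for every $x\in S_Q(b,a-d,-c)$, setting $\lambda=a+bx$, we have $\lambda\in\sigma_l(A)$ and $(1,x)^T\in V_l(\lambda)$. (2) If $S_Q(c,d-a,-b)\neq\emptyset$, then for every $x\in S_Q(c,d-a,-b)$, setting $\lambda=d+cx$, we have $\lambda\in\sigma_l(A)$ and $(x,1)^T\in V_l(\lambda)$.
   Context: $\mathbb{H}_s$ denotes the split quaternion algebra: the associative real algebra with basis $1,\mathbf{i},\mathbf{j},\mathbf{k}$, unit $1$, and multiplication $\mathbf{i}^2=-1$, $\mathbf{j}^2=\mathbf{k}^2=1$, $\mathbf{i}\mathbf{j}=-\mathbf{j}\mathbf{i}=\mathbf{k}$, $\mathbf{j}\mathbf{k}=-\mathbf{k}\mathbf{j}=-\mathbf{i}$, $\mathbf{k}\mathbf{i}=-\mathbf{i}\mathbf{k}=\mathbf{j}$. For $x=x_0+x_1\mathbf{i}+x_2\mathbf{j}+x_3\mathbf{k}$ with $x_i\in\mathbb{R}$, put $\bar x=x_0-x_1\mathbf{i}-x_2\mathbf{j}-x_3\mathbf{k}$ and $I_x=\bar x x=x\bar x=x_0^2+x_1^2-x_2^2-x_3^2$. Let $Z(\mathbb{H}_s)=\{x\in\mathbb{H}_s: I_x=0\}$; this is the set of noninvertible elements (it contains $0$).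 Left eigenvalues: for $A\in\mathbb{H}_s^{n\times n}$, an element $\lambda\in\mathbb{H}_s$ is a left eigenvalue of $A$ if there is $x\in\mathbb{H}_s^n$ with $x\notin Z(\mathbb{H}_s)^n$ (i.e. at least one component of $x$ is invertible) such that $Ax=\lambda x$, where $\lambda x$ is componentwise left multiplication. The set of left eigenvalues of $A$ is the left spectrum $\sigma_l(A)$. For $\lambda\in\sigma_l(A)$, $V_l(\lambda)=\{x\in\mathbb{H}_s^n: Ax=\lambda x\}$. Solution set: for $p,q,r\in\mathbb{H}_s$, $S_Q(p,q,r)=\{x\in\mathbb{H}_s: px^2+qx+r=0\}$. *)

(* Defs.v *)
From HB Require Import structures.
From mathcomp Require Import all_boot all_order all_algebra.
From mathcomp Require Import ring.
From mathcomp Require Import classical_sets reals.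

Set Implicit Arguments.
Unset Strict Implicit.
Unset Printing Implicit Defensive.

Import Order.TTheory GRing.Theory Num.Theory.

Local Open Scope ring_scope.
Local Open Scope classical_set_scope.

(* [SplitQuat x0 x1 x2 x3] is x0 + x1 i + x2 j + x3 k. *)
Record splitquat (R : Type) := SplitQuat
  { sqre : R; sqi : R; sqj : R; sqk : R }.

Section SplitQuaternions.
Variable R : realType.
Implicit Types x y z : splitquat R.

Definition sq_tuple x := (sqre x, sqi x, sqj x, sqk x).
Definition tuple_sq (t : R * R * R * R) : splitquat R :=
  let: (t0, t1, t2, t3) := t in SplitQuat t0 t1 t2 t3.

Lemma sq_tupleK : cancel sq_tuple tuple_sq.
Proof. by case. Qed.

HB.instance Definition _ := Choice.copy (splitquat R) (can_type sq_tupleK).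

Definition sq_zero : splitquat R := SplitQuat 0 0 0 0.
Definition sq_add x y : splitquat R :=
  SplitQuat (sqre x + sqre y) (sqi x + sqi y) (sqj x + sqj y) (sqk x + sqk y).
Definition sq_opp x : splitquat R :=
  SplitQuat (- sqre x) (- sqi x) (- sqj x) (- sqk x).

Lemma sq_addA : associative sq_add.
Proof. by move=> x y z; rewrite /sq_add /= !addrA. Qed.
Lemma sq_addC : commutative sq_add.
Proof. by move=> x y; congr SplitQuat; rewrite addrC. Qed.
Lemma sq_add0 : left_id sq_zero sq_add.
Proof. by case=> *; rewrite /sq_add /= !add0r. Qed.
Lemma sq_addN : left_inverse sq_zero sq_opp sq_add.
Proof. by case=> *; rewrite /sq_add /= !addNr. Qed.

HB.instance Definition _ :=
  GRing.isZmodule.Build (splitquat R) sq_addA sq_addC sq_add0 sq_addN.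

Definition sq_one : splitquat R := SplitQuat 1 0 0 0.

(* The bilinear extension of the multiplication table; see [sq_table]. *)
Definition sq_mul x y : splitquat R :=
  let: SplitQuat x0 x1 x2 x3 := x in
  let: SplitQuat y0 y1 y2 y3 := y in
  SplitQuat (x0 * y0 - x1 * y1 + x2 * y2 + x3 * y3)
            (x0 * y1 + x1 * y0 - x2 * y3 + x3 * y2)
            (x0 * y2 - x1 * y3 + x2 * y0 + x3 * y1)
            (x0 * y3 + x1 * y2 - x2 * y1 + x3 * y0).

Lemma sq_mulA : associative sq_mul.
Proof. by case=> ? ? ? ? [? ? ? ?] [? ? ? ?]; congr SplitQuat; ring. Qed.
Lemma sq_mul1l : left_id sq_one sq_mul.
Proof. by case=> ? ? ? ?; congr SplitQuat; ring. Qed.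
Lemma sq_mul1r : right_id sq_one sq_mul.
Proof. by case=> ? ? ? ?; congr SplitQuat; ring. Qed.
Lemma sq_mulDl : left_distributive sq_mul sq_add.
Proof. by case=> ? ? ? ? [? ? ? ?] [? ? ? ?]; congr SplitQuat => /=; ring. Qed.
Lemma sq_mulDr : right_distributive sq_mul sq_add.
Proof. by case=> ? ? ? ? [? ? ? ?] [? ? ? ?]; congr SplitQuat => /=; ring. Qed.
Lemma sq_one_neq0 : sq_one != 0.
Proof. by apply/eqP => -[] /eqP; rewrite oner_eq0. Qed.

HB.instance Definition _ := GRing.Zmodule_isNzRing.Build (splitquat R)
  sq_mulA sq_mul1l sq_mul1r sq_mulDl sq_mulDr sq_one_neq0.

Definition sq_scale (t : R) x : splitquat R :=
  SplitQuat (t * sqre x) (t * sqi x) (t * sqj x) (t * sqk x).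

Lemma sq_scaleA s t x : sq_scale s (sq_scale t x) = sq_scale (s * t) x.
Proof. by rewrite /sq_scale /= !mulrA. Qed.
Lemma sq_scale1 : left_id 1 sq_scale.
Proof. by case=> *; rewrite /sq_scale /= !mul1r. Qed.
Lemma sq_scaleDr : right_distributive sq_scale +%R.
Proof. by move=> t x y; congr SplitQuat; rewrite mulrDr. Qed.
Lemma sq_scaleDl x : {morph sq_scale^~ x : s t / s + t}.
Proof. by move=> s t; congr SplitQuat; rewrite mulrDl. Qed.

HB.instance Definition _ := GRing.Zmodule_isLmodule.Build R (splitquat R)
  sq_scaleA sq_scale1 sq_scaleDr sq_scaleDl.

Lemma sq_scaleAl (t : R) x y : t *: (x * y) = (t *: x) * y.
Proof. by case: x y => ? ? ? ? [? ? ? ?]; congr SplitQuat => /=; ring. Qed.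

HB.instance Definition _ :=
  GRing.Lmodule_isLalgebra.Build R (splitquat R) sq_scaleAl.

Lemma sq_scaleAr (t : R) x y : t *: (x * y) = x * (t *: y).
Proof. by case: x y => ? ? ? ? [? ? ? ?]; congr SplitQuat => /=; ring. Qed.

HB.instance Definition _ :=
  GRing.Lalgebra_isAlgebra.Build R (splitquat R) sq_scaleAr.

Definition qi : splitquat R := SplitQuat 0 1 0 0.
Definition qj : splitquat R := SplitQuat 0 0 1 0.
Definition qk : splitquat R := SplitQuat 0 0 0 1.

Lemma sq_decomp x :
  x = (sqre x)%:A + sqi x *: qi + sqj x *: qj + sqk x *: qk.
Proof. by case: x => ? ? ? ?; congr SplitQuat => /=; ring. Qed.

Lemma sq_table :
  [/\ [/\ qi * qi = -1, qj * qj = 1 & qk * qk = 1],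
      [/\ qi * qj = qk, qj * qk = - qi & qk * qi = qj] &
      [/\ qj * qi = - qk, qk * qj = qi & qi * qk = - qj]].
Proof. by do !split; congr SplitQuat => /=; ring. Qed.

Definition sq_conj x : splitquat R :=
  SplitQuat (sqre x) (- sqi x) (- sqj x) (- sqk x).

Definition sq_I x : R := sqre x ^+ 2 + sqi x ^+ 2 - sqj x ^+ 2 - sqk x ^+ 2.

Lemma sq_mul_conjl x : sq_conj x * x = (sq_I x)%:A.
Proof. by case: x => ? ? ? ?; congr SplitQuat; rewrite /sq_I /=; ring. Qed.
Lemma sq_mul_conjr x : x * sq_conj x = (sq_I x)%:A.
Proof. by case: x => ? ? ? ?; congr SplitQuat; rewrite /sq_I /=; ring. Qed.

Definition sq_Z : set (splitquat R) := [set x | sq_I x = 0].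

Lemma sq_IM x y : sq_I (x * y) = sq_I x * sq_I y.
Proof. by case: x y => ? ? ? ? [? ? ? ?]; rewrite /sq_I /=; ring. Qed.

Lemma sq_notin_Z x : ~ sq_Z x <-> exists y, x * y = 1 /\ y * x = 1.
Proof.
split=> [/eqP Ix | [y [xy _]] Ix]; last first.
  have := sq_IM x y; rewrite xy Ix mul0r /sq_I /= => /eqP.
  by rewrite expr1n expr0n /= addr0 !subr0 oner_eq0.
exists ((sq_I x)^-1 *: sq_conj x); rewrite -scalerAr -scalerAl.
by rewrite sq_mul_conjl sq_mul_conjr scalerA mulVf // scale1r.
Qed.

Section LeftSpectrum.
Variable n : nat.
Implicit Types A : 'M[splitquat R]_n.

Definition sq_Zn : set 'cV[splitquat R]_n :=
  [set v | forall i, sq_Z (v i 0)].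

(* For matrices over a noncommutative ring, [lambda *: v] multiplies every
   entry of [v] by [lambda] on the left. *)
Definition left_eigenspace A (lambda : splitquat R) : set 'cV[splitquat R]_n :=
  [set v | A *m v = lambda *: v].

Definition left_spectrum A : set (splitquat R) :=
  [set lambda | exists v : 'cV[splitquat R]_n,
     ~ sq_Zn v /\ A *m v = lambda *: v].

End LeftSpectrum.

Definition solQ (p q r : splitquat R) : set (splitquat R) :=
  [set x | p * x ^+ 2 + q * x + r = 0].

Definition mx22 (a b c d : splitquat R) : 'M[splitquat R]_2 :=
  \matrix_(i, j) if i == 0 then (if j == 0 then a else b)
                 else (if j == 0 then c else d).

Definition cv2 (u v : splitquat R) : 'cV[splitquat R]_2 :=
  \col_i if i == 0 then u else v.

End SplitQuaternions.

(* Main.v *)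
Require Import Defs.
From mathcomp Require Import all_boot all_order all_algebra.
From mathcomp Require Import classical_sets reals.

Import Order.TTheory GRing.Theory Num.Theory.

Local Open Scope ring_scope.
Local Open Scope classical_set_scope.

(** For a vector with entries [1] and [x], the row of [A] at the entry [1] forces the value of
    [lambda]; the other row then becomes the quadratic equation for [x] ([solQ_opp]). The entry [1]
    is invertible, so the vector is an admissible eigenvector ([left_eigenpair]). *)

Lemma mx22_cv2 (R : realType) (a b c d u v : splitquat R) :
  mx22 a b c d *m cv2 u v = cv2 (a * u + b * v) (c * u + d * v).
Proof.
apply/matrixP => i j; rewrite !mxE !big_ord_recl big_ord0 !mxE /= addr0.
by case: ifP.
Qed.

Lemma scale_cv2 (R : realType) (l u v : splitquat R) :
  l *: cv2 u v = cv2 (l * u) (l * v).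
Proof. by apply/matrixP => i j; rewrite !mxE; case: ifP. Qed.

Lemma sq_one_notin_Z (R : realType) : ~ sq_Z (1 : splitquat R).
Proof. by apply/sq_notin_Z; exists 1; rewrite mulr1. Qed.

(** Expanding the right side gives [s * x + p * x ^+ 2] without commuting any factors:
    [lambda = s + p * x] acts on the left, just as the coefficients of the quadratic do. *)
Lemma solQ_opp (R : realType) (p s t r x : splitquat R) :
  x \in solQ p (s - t) (- r) -> r + t * x = (s + p * x) * x.
Proof.
rewrite inE /solQ /= expr2 mulrBl mulrDl mulrA => /eqP.
by rewrite subr_eq0 addrA subr_eq addrC => /eqP <-.
Qed.

(** One entry with nonzero [sq_I] already keeps [v] out of [sq_Zn]. *)
Lemma left_eigenpair (R : realType) n (A : 'M[splitquat R]_n) l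
    (v : 'cV[splitquat R]_n) i :
  ~ sq_Z (v i 0) -> A *m v = l *: v ->
  l \in left_spectrum A /\ v \in left_eigenspace A l.
Proof.
by move=> vi Av; split; apply/mem_set => //; exists v; split=> // /(_ i).
Qed.

Theorem theorem3p3 (R : realType) (a b c d : splitquat R)
    (hb : b != 0) (hc : c != 0) :
  let A := mx22 a b c d in
  (solQ b (a - d) (- c) !=set0 ->
     forall x, x \in solQ b (a - d) (- c) ->
       let lambda := a + b * x in
       lambda \in left_spectrum A /\ cv2 1 x \in left_eigenspace A lambda)
  /\
  (solQ c (d - a) (- b) !=set0 ->
     forall x, x \in solQ c (d - a) (- b) ->
       let lambda := d + c * x in
       lambda \in left_spectrum A /\ cv2 x 1 \in left_eigenspace A lambda).
Proof.
move=> A; split=> _ x /solQ_opp xE l.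
- apply: (@left_eigenpair _ _ _ _ _ 0).
    by rewrite mxE; exact: sq_one_notin_Z.
  (* The top row is the definition of [l]; the bottom row is [xE]. *)
  by rewrite mx22_cv2 scale_cv2 !mulr1 xE.
(* The entry [1] is now at the bottom, so the rows swap roles: the top one is [xE], up to the order
   of the sums. *)
- apply: (@left_eigenpair _ _ _ _ _ 1).
    by rewrite mxE; exact: sq_one_notin_Z.
  by rewrite mx22_cv2 scale_cv2 !mulr1 addrC xE [c * x + d]addrC.
Qed.
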